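(* Let $\pi\colon X\to Y$ be a factor map between the topological dynamical systems $(X,T,G)$ and $(Y,S,G)$, where $G$ is an infinite group with a proper right-invariant distance $d$ for which the inverse map is an isometry, i.e. $d(g^{-1},h^{-1})=d(g,h)$ for all $g,h\in G$. Assume that $\pi$ is not bounded to one. Let $k\in G$ be an element generating an unbounded subgroup $\langle k\rangle$. Then, for any $\epsilon>0$, there exists a horoball $H$ of $(G,d)$ such that - the horoball $H$ does not contain $k$; - there exists an $(\epsilon,H)$-asymptotic pair $(x,y)$ relative to $\pi$.
   Context: $G$ is a second countable, locally compact topological group with identity $1_G$, and $d$ is a metric on $G$ inducing its topology which is right-invariant ($d(gf,hf)=d(g,h)$) and proper (closed balls are compact). Write $B_R(g)=\{h\in G: d(h,g)<R\}$. For $g\in G$ let $b_g\colon G\to\mathbb{R}$, $b_g(x)=d(g,x)-d(g,1_G)$. A sequence $(g_n)$ in $G$ goes to infinity if for every $m$, $g_n\notin B_m(1_G)$ for all large enough $n$. A horofunction is a function $j\colon G\to\mathbb{R}$ that is the limit, uniformly on compact sets, of $(b_{g_n})$ for some sequence $(g_n)$ in $G$ going to infinity; $\partial G$ is the set of horofunctions. A horoball is a set $\{x\in G: j(x)<0\}$ with $j\in\partial G$ (it may be empty). A topological dynamical system $(X,T,G)$ is a continuous left action $T\colon G\times X\to X$ of $G$ on a compact metric space $X$ with distance $\operatorname{dist}$; $T_g=T(g,\cdot)$ and $T_g\circ T_h=T_{gh}$. A factor map $\pi\colon X\to Y$ is a continuous onto map with $S_g\circ\pi=\pi\circ T_g$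 for all $g\in G$. It is bounded to one if the cardinality of its fibers $\pi^{-1}(y)$ is uniformly bounded by a finite constant. An $(\epsilon,H)$-asymptotic pair relative to $\pi$ is a pair $(x,y)$ of two different points of $X$ with $\pi(x)=\pi(y)$ and $\operatorname{dist}(T_gx,T_gy)\le\epsilon$ for all $g\in H$. *)

(* Defs.v *)
From HB Require Import structures.
From mathcomp Require Import all_boot all_order all_algebra.
From mathcomp Require Import all_classical all_reals all_analysis.

Set Implicit Arguments.
Unset Strict Implicit.
Unset Printing Implicit Defensive.

Import Order.TTheory GRing.Theory Num.Theory.
Import numFieldNormedType.Exports.

Local Open Scope classical_set_scope.
Local Open Scope ring_scope.

HB.mixin Record TopologicalGroup_of_Group G & Topological G & Group G := {
  mulg_continuous : continuous (fun p : G * G => (p.1 * p.2)%g) ;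
  invg_continuous : continuous (fun g : G => (g^-1)%g)
}.

#[short(type="topologicalGroupType")]
HB.structure Definition TopologicalGroup :=
  {G of Topological G & Group G & TopologicalGroup_of_Group G}.

(* A topological group with a metric inducing its topology; no invariance of
   the metric is part of the structure. *)
#[short(type="metricGroupType")]
HB.structure Definition MetricGroup (R : numDomainType) :=
  {G of Metric R G & TopologicalGroup G}.

Section Metric.
Context {R : realType}.

Definition right_invariant (G : metricGroupType R) :=
  forall f g h : G, mdist (g * f)%g (h * f)%g = mdist g h.

Definition inverse_isometry (G : metricGroupType R) :=
  forall g h : G, mdist (g^-1)%g (h^-1)%g = mdist g h.

(* [closed_ball] of the library is the closure of the open ball, which may be
   smaller than the closed ball meant here. *)
Definition proper_metric (M : metricType R) :=
  forall (x : M) (r : R), compact [set y : M | mdist y x <= r].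

(* [bounded_set] of the library requires a normed module. *)
Definition metric_bounded (M : metricType R) (A : set M) :=
  exists (x : M) (r : R), A `<=` ball x r.

End Metric.

Definition cyclic_subgroup (G : groupType) (k : G) : set G :=
  [set g | exists n : nat, g = (k ^+ n)%g \/ g = (k ^- n)%g].

Section Horoballs.
Context {R : realType} {G : metricGroupType R}.

Definition busemann (g x : G) : R := mdist g x - mdist g 1%g.

Definition goes_to_infinity (g : nat -> G) :=
  forall m : nat, \forall n \near \oo, ~ ball (1%g : G) m%:R (g n).

Definition horofunction (j : G -> R) :=
  exists2 g : nat -> G, goes_to_infinity g &
    {family compact, (fun n => busemann (g n)) @ \oo --> j}.

Definition horoball (H : set G) :=
  exists2 j : G -> R, horofunction j & H = [set x | j x < 0].

End Horoballs.

Section Dynamics.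
Context {R : realType} {G : metricGroupType R}.

Definition dynamical_system (X : metricType R) (T : G -> X -> X) :=
  [/\ compact [set: X],
      continuous (fun p : G * X => T p.1 p.2),
      forall x, T 1%g x = x &
      forall g h x, T g (T h x) = T (g * h)%g x].

Definition factor_map (X Y : metricType R) (T : G -> X -> X) (S : G -> Y -> Y)
    (pi : X -> Y) :=
  [/\ continuous pi, range pi = [set: Y] &
      forall g x, S g (pi x) = pi (T g x)].

Definition bounded_to_one (X Y : Type) (pi : X -> Y) :=
  exists N : nat, forall y, (pi @^-1` [set y] #<= `I_N)%card.

Definition asymptotic_pair (X : metricType R) (Y : Type) (T : G -> X -> X)
    (pi : X -> Y) (eps : R) (H : set G) (x y : X) :=
  [/\ x <> y, pi x = pi y &
      forall g, H g -> mdist (T g x) (T g y) <= eps].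

End Dynamics.

(* Main.v *)
Require Import Defs.
From mathcomp Require Import all_boot all_order all_algebra.
From mathcomp Require Import all_classical all_reals all_analysis.
From mathcomp Require Import lra.

(** An isometric inverse makes a right-invariant metric bi-invariant. For two points [x],
    [y] of a fibre let [A] be the set of times [g] at which [T g x] and [T g y] are
    [eps]-close. If [A] is the whole group for some [x <> y], any horoball that avoids
    [k] works, and one exists because the powers of [k] have unbounded norms
    ([exists_norm_nondecreasing_power]).

    Otherwise every [A] misses a point. Take a large ball contained in [A], enlarge it
    until it meets a point [g] outside [A], and translate by [g]: the pair [T g x],
    [T g y] is at distance at least [eps], and it is [eps]-close on a large ball with
    the identity on its boundary. When the radius grows, such balls converge to
    horoballs and such pairs to asymptotic pairs ([asymptotic_pair_of_sequences]).

    The point of the theorem is that the horoball can be made to avoid [k]. For a ball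
    around [c] blocked by [g], this requires that [k * g] be no closer to [c] than [g]
    ([exit_point]). If this fails for all the balls in question, then the radius of the
    largest ball around [c] contained in [A] increases by at least [delta] when [c] is
    replaced by [k * c] ([clear_ball_grows]). A fixed large ball around [k ^- m]
    contained in [A] thus forces a ball around the identity of radius at least
    [m * delta] to lie in [A] ([clear_ball_spreads]). Here large fibres come in: by
    compactness of [X], among sufficiently many points of one fibre there is, for every
    [m], a pair which is close on a given ball around [k ^- m]
    ([close_pair_among_many]). As only finitely many pairs are available while [m] is
    arbitrary, some pair would be close everywhere, which has been excluded
    ([exists_exit_point]). *)

Set Implicit Arguments.
Unset Strict Implicit.
Unset Printing Implicit Defensive.

Import Order.TTheory GRing.Theory Num.Theory.
Import numFieldNormedType.Exports.

Local Open Scope classical_set_scope.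
Local Open Scope ring_scope.

(** * Compactness, ultrafilters and finite families *)

(** The finite sets of centres, directed by inclusion, form a filter; near-covering
    compactness applied to it says that the centres of some finite set suffice. *)
Lemma compact_finite_subcover (T : topologicalType) (U : T -> set T) :
  compact [set: T] -> (forall x, nbhs x (U x)) ->
  exists s : seq T, forall x, exists2 i, i \in s & U i x.
Proof.
move=> /compact_near_coveringP cT nU.
pose F := filter_from setT (fun s0 : seq T => [set s : seq T | {subset s0 <= s}]).
have FF : ProperFilter F.
  apply: filter_from_proper; last by move=> s _; exists s => x.
  apply: filter_from_filter; first by exists [::].
  move=> s t _ _; exists (s ++ t) => // u /= stu.
  by split=> x xs; apply: stu; rewrite mem_cat xs ?orbT.
have /filter_ex[s sP] : \forall s \near F, [set: T] `<=`
    [set x | exists2 i, i \in s & U i x].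
  apply: (cT _ F (fun s x => exists2 i, i \in s & U i x)) => x _.
  exists (U x, [set s | x \in s]) => /=; last first.
    by move=> [y s] [/= Uxy xs]; exists x.
  by split=> //; exists [:: x] => // s /=; apply; rewrite mem_head.
by exists s => x; exact: sP.
Qed.

(** Limits along one fixed ultrafilter replace repeated extraction of subsequences:
    all the sequences of the argument converge along the same ultrafilter. *)
Lemma ultra_compact_cvg (T : topologicalType) (K : set T) (I : Type)
    (U : set_system I) (f : I -> T) :
  UltraFilter U -> compact K -> (forall i, K (f i)) ->
  exists2 p, K p & f @ U --> p.
Proof.
move=> UU cK Kf; have [|p [Kp clp]] := cK (f @ U) _.
  by apply: (@filterE _ U _ (f @^-1` K)) => i; exact: Kf.
exists p => // N nN; have [//|UN] := in_ultra_setVsetC (f @^-1` N) UU.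
by have [z [/= nNz Nz]] := clp (~` N) N UN nN.
Qed.

(** Only finitely many points of a large fibre are used, so that finitely many pairs
    have to be controlled in [exists_exit_point]. *)
Lemma card_gt_inj (T : Type) (A : set T) (n : nat) : ~ (A #<= `I_n)%card ->
  exists2 z : 'I_n.+1 -> T, injective z & forall i, A (z i).
Proof.
move=> An.
have : (`I_n.+1 #<= A)%card.
  have [/finite_setP[m Am]|/infiniteP Ai] := pselect (finite_set A).
    rewrite (card_le_eqr Am) card_le_II ltnNge; apply/negP => mn.
    by apply: An; rewrite (card_le_eql Am) card_le_II.
  exact: card_le_trans (subset_card_le _) Ai.
move=> /card_leP[f].
exists (fun i : 'I_n.+1 =>
  val (f (SigSub (mem_set (ltn_ord i : `I_n.+1 (nat_of_ord i)))))).
  move=> i j /val_inj/'inj_f; rewrite !inE => /(_ I I)/(congr1 val)/= ij.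
  exact: val_inj.
by move=> i; exact: set_valP.
Qed.

(** * Metric spaces *)

Lemma ler_dist_mdist (R : realType) (M : metricType R) (g x y : M) :
  `|mdist g x - mdist g y| <= mdist x y.
Proof.
have := metric_triangle g x y; have := metric_triangle g y x.
rewrite (metric_sym y x) ler_norml; lra.
Qed.

Lemma near_mdist_lt (R : realType) (M : metricType R) (x : M) (e : R) :
  0 < e -> \forall y \near x, mdist x y < e.
Proof. by move=> /(nbhsx_ballx x); rewrite ballEmdist. Qed.

Lemma mdist_cvg (R : realType) (M : metricType R) (I : Type)
    (F : set_system I) {FF : Filter F} (u v : I -> M) (x y : M) :
  u @ F --> x -> v @ F --> y ->
  (fun i => mdist (u i) (v i)) @ F --> mdist x y.
Proof.
move=> ux vy; apply/cvgrPdist_lt => e e0; have e2 : 0 < e / 2 by lra.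
near=> i.
have xu : mdist x (u i) < e / 2.
  by near: i; exact: metricType_numDomainType.cvgr_dist_lt.
have yv : mdist y (v i) < e / 2.
  by near: i; exact: metricType_numDomainType.cvgr_dist_lt.
have := ler_dist_mdist y x (u i); have := ler_dist_mdist (u i) y (v i).
rewrite !(metric_sym y) in xu yv *; rewrite !ler_norml ltr_norml.
move: xu yv; rewrite (metric_sym (v i) y) => *; lra.
Unshelve. all: by end_near. Qed.

Lemma compact_sub_ball (R : realType) (M : metricType R) (K : set M) (c : M) :
  compact K -> exists m : nat, K `<=` ball c m%:R.
Proof.
move=> /compact_near_coveringP cK.
have /filter_ex[m mP] : \forall m \near \oo, K `<=` ball c m%:R; last by exists m.
apply: (cK _ \oo (fun m => ball c m%:R)) => x _.
near=> y m; rewrite ballEmdist /=.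
apply: (le_lt_trans (metric_triangle c x y)).
have xy : mdist x y < 1 by near: y; exact: near_mdist_lt.
apply: (@lt_trans _ _ (mdist c x + 1)); first by rewrite ltrD2l.
near: m; exact: nbhs_infty_gtr.
Unshelve. all: by end_near. Qed.

(** The complement of [A] need not be closed, hence may have no point nearest to [c];
    nearest up to [delta] is enough, since [delta] tends to [0] in the end. *)
Lemma exists_almost_nearest_outside (R : realType) (M : metricType R)
    (A : set M) (c h : M) (delta : R) :
  0 < delta -> ~ A h ->
  exists g, [/\ ~ A g, mdist c g <= mdist c h &
                ball c (mdist c g - delta) `<=` A].
Proof.
move=> delta0 nAh; pose E := [set mdist c g | g in ~` A].
have Elb : lbound E 0 by move=> _ [g _ <-]; exact: mdist_ge0.
have Einf : has_inf E by split; [exists (mdist c h), h | exists 0].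
have [_ [g nAg <-] gE] := inf_adherent delta0 Einf.
have clear s : s < inf E + delta -> ball c (s - delta) `<=` A.
  move=> sE f; rewrite ballEmdist /= => fs; apply: contrapT => nAf.
  have : inf E <= mdist c f by apply: ge_inf; [exact: Einf.2 | exists f].
  by lra.
have [gh|hg] := leP (mdist c g) (mdist c h).
  by exists g; split=> //; exact: clear.
by exists h; split=> //; apply: clear; exact: lt_trans gE.
Qed.

Lemma cvg_compact_family (R : realType) (M : topologicalType) (I : Type)
    (F : set_system I) {FF : Filter F} (f : I -> M -> R) (j : M -> R) :
  (forall K e, compact K -> 0 < e ->
     \forall n \near F, forall x, K x -> `|j x - f n x| < e) ->
  {family compact, f @ F --> j}.
Proof.
move=> H; apply/fam_cvgP => K cK P; rewrite uniform_nbhs => -[E [+ EP]].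
rewrite -entourage_ballE => -[e /= e0 eE].
have := H K e cK e0; apply: filterS => n fn; apply: EP => x Kx.
by apply: eE => /=; exact: fn.
Qed.

(** * Balls in a group with a bi-invariant metric *)

Section BiInvariant.
Context {R : realType} {G : metricGroupType R}.
Hypotheses (d_right_invariant : right_invariant G)
  (d_inverse : inverse_isometry G).

Lemma left_invariant (f g h : G) : mdist (f * g)%g (f * h)%g = mdist g h.
Proof.
by rewrite -(d_inverse (f * g)%g) !invgM d_right_invariant d_inverse.
Qed.

(** The point [g] is, up to [delta], a point outside [A] nearest to the centre [c]; it is
    at distance at least [n] from [c], and multiplying it by [k] does not bring it
    closer to [c] by more than [delta]. After translation by the inverse of [g], the
    ball around [c] that stops short of [g] turns into a ball around [c * g^-1] with
    [1] on its boundary and with [k] outside, up to [delta]: an approximate horoball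
    avoiding [k]. *)
Definition exit_point (k : G) (n delta : R) (A : set G) (c g : G) :=
  [/\ ~ A g, n <= mdist c g, ball c (mdist c g - delta) `<=` A &
      mdist c g - delta <= mdist c (k * g)%g].

(** Let [g] be almost nearest to [c] outside [A]. If the ball around [k^-1 * c] lies in
    [A], then [k * g] is at distance at least [r] from [c], because left translation by
    [k] is an isometry. As [g] is no exit point, [g] itself is farther still, by
    [delta]. The margin [mdist 1 k] on [r] ensures that [g] is at distance at least [n]
    from [c]. *)
Lemma clear_ball_grows (k : G) (n delta r : R) (A : set G) (c : G) :
  0 < delta -> (forall c g, ~ exit_point k n delta A c g) ->
  n + mdist 1%g k <= r -> ball (k^-1 * c)%g r `<=` A ->
  ball c (r + delta) `<=` A.
Proof.
move=> delta0 noexit nr clear h; rewrite ballEmdist /= => hc.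
apply: contrapT => nAh.
have [g [nAg gh gclear]] :=
  exists_almost_nearest_outside c delta0 nAh.
have shift f : mdist (k^-1 * c)%g f = mdist c (k * f)%g.
  by rewrite -(left_invariant k (k^-1 * c)%g) mulVKg.
have far f : ~ A f -> r <= mdist c (k * f)%g.
  by move=> nAf; rewrite leNgt -shift; apply/negP => fr; apply: nAf;
     apply: clear; rewrite ballEmdist.
have ng : n <= mdist c g.
  have := far _ nAg; have := metric_triangle c g (k * g)%g.
  by have := d_right_invariant g 1%g k; rewrite mul1g; lra.
apply: (noexit c g); split=> //.
by have := far _ nAg; lra.
Qed.

Lemma clear_ball_spreads (k : G) (n delta : R) (A : set G) (m : nat) (r : R) :
  0 < delta -> (forall c g, ~ exit_point k n delta A c g) ->
  n + mdist 1%g k <= r -> ball (k ^- m)%g r `<=` A ->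
  ball (1%g : G) (r + m%:R * delta) `<=` A.
Proof.
move=> delta0 noexit; elim: m r => [|m IH] r nr clear.
  by rewrite mul0r addr0; rewrite expg0 invg1 in clear.
rewrite -natr1 mulrDl mul1r (addrC (m%:R * _)) addrA.
apply: IH; first by lra.
apply: (@clear_ball_grows k n) => //.
by rewrite -invgM -expgSr.
Qed.

(** Without exit points, each clear ball around [k ^- m] makes one of the [A j] clear on
    a ball around [1] of radius at least [m * delta]. As there are finitely many [j],
    a large [m] contradicts that every [A j] misses a point. *)
Lemma exists_exit_point (k : G) (n delta : R) (J : finType) (A : J -> set G) :
  0 < delta ->
  (forall m : nat, exists j, ball (k ^- m)%g (n + mdist 1%g k) `<=` A j) ->
  (forall j, exists g, ~ A j g) ->
  exists j c g, exit_point k n delta (A j) c g.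
Proof.
move=> delta0 clear /choice[h nAh]; apply: contrapT => noexit.
set r := n + mdist 1%g k in clear.
have [m hm] : exists m : nat, forall j, mdist 1%g (h j) < r + m%:R * delta.
  suff : \forall m \near \oo, forall j, mdist 1%g (h j) < r + m%:R * delta.
    by move=> /filter_ex.
  apply: filter_forall => j; near=> m; rewrite -ltrBlDl -ltr_pdivrMr //; near: m.
  exact: nbhs_infty_gtr.
have [j cj] := clear m.
apply: (nAh j); apply: (@clear_ball_spreads k n delta (A j) m r) => //.
- by move=> c g E; apply: noexit; exists j, c, g.
- by rewrite ballEmdist /=.
Unshelve. all: by end_near. Qed.

Lemma exists_norm_nondecreasing_power (k : G) (M : R) :
  ~ metric_bounded (cyclic_subgroup k) ->
  exists i : nat,
    M <= mdist 1%g (k ^- i)%g /\ mdist 1%g (k ^- i)%g <= mdist k (k ^- i)%g.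
Proof.
move=> unb; pose a i := mdist (1%g : G) (k ^+ i)%g.
have normV i : mdist (1%g : G) (k ^- i)%g = a i by rewrite -d_inverse invg1 invgK.
have aS i : mdist k (k ^- i)%g = a i.+1.
  by rewrite -d_inverse invgK -(left_invariant k (k^-1)%g) mulgV -expgS.
(* The first power whose norm reaches [L] is longer than its predecessor, and the
   norm of that predecessor is at least [L - mdist 1 k], hence at least [M]. *)
set L := `|M| + mdist 1%g k + 1.
have big : exists i, L <= a i.
  apply: contrapT => small; apply: unb; exists 1%g, L => g [i gi].
  have -> : ball (1%g : G) L g = (a i < L) :> Prop.
    by rewrite ballEmdist /=; case: gi => ->; rewrite ?normV.
  by rewrite ltNge; apply/negP => Li; apply: small; exists i.
case: (ex_minnP big) => -[|i] Li imin.
  have := mdist_ge0 (1%g : G) k; have := normr_ge0 M.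
  by move: Li; rewrite /a expg0 mdistxx /L; lra.
have ltL : a i < L by rewrite ltNge; apply/negP => /imin; rewrite ltnn.
have lip : a i.+1 <= mdist 1%g k + a i.
  rewrite /a expgS -[in leRHS](left_invariant k 1%g (k ^+ i)%g) mulg1.
  exact: metric_triangle.
have := ler_norm M; exists i; rewrite normV aS.
by split; move: Li ltL lip; rewrite /L; lra.
Qed.
End BiInvariant.

(** * Limits of Busemann functions *)

Section Busemann.
Context {R : realType} {G : metricGroupType R}.

Lemma busemann_lipschitz (g x y : G) : `|busemann g x - busemann g y| <= mdist x y.
Proof. by rewrite /busemann opprB addrA subrK ler_dist_mdist. Qed.

(** The functions [busemann (c n)] are 1-Lipschitz, so pointwise convergence along the
    ultrafilter is uniform on compact sets. As closed balls are compact, one can pick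
    for each [m] an index [n_ m >= m] at which the limit is approximated within
    [1 / (m + 1)] on the ball of radius [m]; every compact set lies in such a ball,
    and [c \o n_] is then a genuine sequence that defines [j]. *)
Lemma ultra_horofunction (c : nat -> G) (U : set_system nat) (j : G -> R) :
  proper_metric G -> UltraFilter U -> \oo `<=` U ->
  (forall n : nat, n%:R <= mdist 1%g (c n)) ->
  (forall x, (fun n => busemann (c n) x) @ U --> j x) -> horofunction j.
Proof.
move=> proper UU ooU cinf cvgj.
have Ufam K e : compact K -> 0 < e ->
    \forall n \near U, forall x, K x -> `|j x - busemann (c n) x| < e.
  move=> /compact_near_coveringP cK e0.
  have e3 : 0 < e / 3 by lra.
  (* The Lipschitz bound passes to the limit. *)
  have jlip x y : `|j x - j y| <= mdist x y.
    have : (fun n => `|busemann (c n) x - busemann (c n) y|) @ U --> `|j x - j y|.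
      by apply: cvg_norm; apply: cvgB; exact: cvgj.
    move=> /cvgr_to_le; apply; apply: filterE => n; exact: busemann_lipschitz.
  apply: (cK _ U (fun n x => `|j x - busemann (c n) x| < e)) => x _.
  near=> y n.
  have xy : mdist x y < e / 3 by near: y; exact: near_mdist_lt.
  have jx : `|j x - busemann (c n) x| < e / 3.
    by near: n; move: (cvgj x) => /cvgrPdist_lt /(_ _ e3).
  have := jlip x y; have := busemann_lipschitz (c n) x y.
  move: jx xy; rewrite !ltr_norml !ler_norml; lra.
have pick m : exists n : nat, (m <= n)%N /\
    forall x : G, mdist x 1%g <= m%:R -> `|j x - busemann (c n) x| < m.+1%:R^-1.
  apply: (@filter_ex _ U _); apply: filterI.
    by apply: ooU; exact: nbhs_infty_ge.
  by apply: Ufam; [exact: proper | rewrite invr_gt0].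
have [n_ nP] := choice pick.
exists (c \o n_).
  move=> m; near=> n; rewrite ballEmdist /= => cm.
  have [nn _] := nP n; have := cinf (n_ n).
  rewrite leNgt => /negP; apply; apply: (lt_le_trans cm).
  rewrite ler_nat; apply: leq_trans nn; near: n; exact: nbhs_infty_ge.
apply: cvg_compact_family => K e cK e0.
have [m Km] := compact_sub_ball 1%g cK.
near=> n => x /Km; rewrite ballEmdist /= metric_sym => xm.
have [_ /(_ x) nx] := nP n.
apply: (@lt_trans _ _ n.+1%:R^-1); last first.
  by near: n; exact: (near_infty_natSinv_lt (PosNum e0)).
apply: nx; apply: (le_trans (ltW xm)); rewrite ler_nat.
by near: n; exact: nbhs_infty_ge.
Unshelve. all: by end_near. Qed.

End Busemann.

(** * Close pairs in a dynamical system *)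

Section Dynamics.
Context {R : realType} {G : metricGroupType R}.
Context {X Y : metricType R}.
Implicit Types (T : G -> X -> X) (S : G -> Y -> Y) (pi : X -> Y).

Definition eps_close_times T (eps : R) (x y : X) : set G :=
  [set g | mdist (T g x) (T g y) <= eps].

Lemma act_continuous T (I : Type) (F : set_system I) {FF : Filter F} (g : G)
    (u : I -> X) (x : X) :
  dynamical_system T -> u @ F --> x -> (fun i => T g (u i)) @ F --> T g x.
Proof.
move=> [_ cT _ _] ux.
exact: (cvg_comp _ _ (cvg_pair (cvg_cst g) ux) (cT (g, x))).
Qed.

(** Compactness of [K] makes the continuity of the action uniform in the group
    element. *)
Lemma near_uniformly_close T (K : set G) (eps : R) (x : X) :
  dynamical_system T -> compact K -> 0 < eps ->
  \forall y \near x, forall h, K h -> mdist (T h x) (T h y) < eps.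
Proof.
move=> [_ cT _ _] /compact_near_coveringP cK eps0.
apply: (cK _ (nbhs x) (fun y h => mdist (T h x) (T h y) < eps)) => h _.
have e2 : 0 < eps / 2 by lra.
(* One product neighbourhood of [(h, x)] controls both [T h' x] and [T h' y], which
   are then compared through [T h x]. *)
have := near_mdist_lt (T h x) e2.
move=> /(cT (h, x))[[A B] [/= nA nB] AB].
exists (A, B) => // -[h' y] [/= Ah' By].
have := AB (h', x) (conj Ah' (nbhs_singleton nB)).
have := AB (h', y) (conj Ah' By) => /=.
have := metric_triangle (T h' x) (T h x) (T h' y).
by rewrite (metric_sym (T h' x) (T h x)); lra.
Qed.

(** Cover [X] by [N] sets whose points stay [eps]-close under all group elements of norm
    at most [r]. Among the images under [T c] of [N + 1] points, two lie in the same
    set; since the metric is right-invariant, undoing [T c] moves the ball around [1]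
    to the ball around [c]. The same [N] serves all centres [c]. *)
Lemma close_pair_among_many T (eps r : R) :
  right_invariant G -> proper_metric G -> dynamical_system T -> 0 < eps ->
  exists N : nat, forall (z : 'I_N.+1 -> X) (c : G), exists i j,
    i != j /\ ball c r `<=` eps_close_times T eps (z i) (z j).
Proof.
move=> rinv proper Tsys eps0; have [cX cT T1 TM] := Tsys.
have e2 : 0 < eps / 2 by lra.
have [s sP] := compact_finite_subcover cX
  (fun x => near_uniformly_close x Tsys (proper (1%g : G) r) e2).
exists (size s) => z c.
have /choice[f fP] : forall i, exists l : 'I_(size s), forall h,
    mdist h 1%g <= r ->
    mdist (T h (tnth (in_tuple s) l)) (T h (T c (z i))) < eps / 2.
  move=> i; have [x xs xP] := sP (T c (z i)).
  by have /tnthP[l xl] : x \in in_tuple s by []; exists l; rewrite -xl.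
have [i [j [ij fij]]] : exists i j, i != j /\ f i = f j.
  apply: contrapT => finj; have := leq_card f _.
  rewrite !card_ord ltnn => /(_ _)/notF; apply => i j fij.
  by apply/eqP; apply: contrapT => /negP ij; apply: finj; exists i, j.
exists i, j; split=> // g; rewrite ballEmdist /= => cg.
have gc : mdist (g * c^-1)%g 1%g <= r.
  by rewrite -(rinv c) mulgVK mul1g metric_sym ltW.
have act x : T g x = T (g * c^-1)%g (T c x) by rewrite TM mulgVK.
have := fP i _ gc; have := fP j _ gc; rewrite -fij -!act.
set w := T _ (tnth _ _) => wj wi.
rewrite /eps_close_times /=; have := metric_triangle (T g (z i)) w (T g (z j)).
by rewrite (metric_sym _ w); lra.
Qed.

(** Compactness step: pairs of points that are [eps]-close on approximate horoballs with
    centres [c n] going to infinity accumulate on a pair that is [eps]-close on the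
    horoball of a limit of the functions [busemann (c n)]. The separation [eta] keeps
    the two limit points distinct. The strict inequality [j h < 0] absorbs the errors
    [1 / (n + 1)] in the closeness hypothesis, and [j k < 0] is excluded because the
    errors in the lower bound on [busemann (c n) k] vanish in the limit. *)
Lemma asymptotic_pair_of_sequences T S pi (eps eta : R) (k : G)
    (c : nat -> G) (x y : nat -> X) :
  proper_metric G -> dynamical_system T -> factor_map T S pi -> 0 < eta ->
  (forall n : nat, n%:R <= mdist 1%g (c n)) ->
  (forall n : nat, - n.+1%:R^-1 <= busemann (c n) k) ->
  (forall n, pi (x n) = pi (y n)) ->
  (forall n, eta <= mdist (x n) (y n)) ->
  (forall n h, busemann (c n) h < - n.+1%:R^-1 ->
     mdist (T h (x n)) (T h (y n)) <= eps) ->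
  exists H : set G, [/\ horoball H, ~ H k &
    exists x y, asymptotic_pair T pi eps H x y].
Proof.
move=> proper Tsys [cpi _ _] eta0 cinf ck pixy etaxy close.
have [cX _ _ _] := Tsys.
have [U [UU ooU]] := ultraFilterLemma (@eventually_filter : ProperFilter \oo).
have small e : 0 < e -> \forall n \near U, n.+1%:R^-1 < e :> R.
  by move=> e0; apply: ooU; exact: (near_infty_natSinv_lt (PosNum e0)).
have [xl _ xcvg] := ultra_compact_cvg (f := x) UU cX (fun=> I).
have [yl _ ycvg] := ultra_compact_cvg (f := y) UU cX (fun=> I).
have /choice[j jcvg] : forall h, exists l : R, (fun n => busemann (c n) h) @ U --> l.
  move=> h.
  have [n|p _ pP] := @ultra_compact_cvg R `[- mdist h 1%g, mdist h 1%g] _ U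
      (fun n => busemann (c n) h) UU (@segment_compact _ _ _); last by exists p.
  by rewrite /= in_itv /= -ler_norml /busemann ler_dist_mdist.
exists [set h | j h < 0]; split.
- by exists j => //; exact: ultra_horofunction ooU cinf jcvg.
- apply/negP; rewrite -leNgt; apply/ler_addgt0Pl => e e0.
  rewrite -lerBlDl sub0r; apply: (cvgr_to_ge (jcvg k)).
  near=> n; apply: le_trans (ck n); rewrite lerN2 ltW //.
  by near: n; exact: small.
exists xl, yl; split.
- have /(lt_le_trans eta0) : eta <= mdist xl yl.
    apply: (cvgr_to_ge (mdist_cvg xcvg ycvg)); exact: filterE.
  by rewrite mdist_gt0 => /eqP.
- have pix : pi (x n) @[n --> U] --> pi xl by exact: (cvg_comp _ _ xcvg (cpi xl)).
  have piy : pi (x n) @[n --> U] --> pi yl.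
    under eq_fun do rewrite pixy.
    exact: (cvg_comp _ _ ycvg (cpi yl)).
  by apply: cvg_unique pix piy; exact: metric_hausdorff.
move=> h /= jh.
apply: (cvgr_to_le (mdist_cvg (act_continuous (g := h) Tsys xcvg)
                              (act_continuous (g := h) Tsys ycvg))).
near=> n; apply: close.
have jn : busemann (c n) h < j h / 2.
  by near: n; apply: (cvgr_lt _ (jcvg h)); lra.
apply: (lt_trans jn); rewrite ltrNr.
by near: n; apply: small; lra.
Unshelve. all: by end_near. Qed.

End Dynamics.

(** * Asymptotic pairs relative to a factor map *)

Theorem theorem4p4 (R : realType) (G : metricGroupType R)
    (G_second_countable : @second_countable G)
    (G_locally_compact : locally_compact [set: G])
    (d_right_invariant : right_invariant G)
    (d_proper : proper_metric G)
    (G_infinite : infinite_set [set: G])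
    (d_inverse : inverse_isometry G)
    (X Y : metricType R) (T : G -> X -> X) (S : G -> Y -> Y)
    (T_system : dynamical_system T) (S_system : dynamical_system S)
    (pi : X -> Y) (pi_factor : factor_map T S pi)
    (pi_unbounded : ~ bounded_to_one pi)
    (k : G) (k_unbounded : ~ metric_bounded (cyclic_subgroup k))
    (eps : R) (eps_gt0 : 0 < eps) :
  exists H : set G,
    [/\ horoball H, ~ H k &
        exists x y : X, asymptotic_pair T pi eps H x y].
Proof.
have [_ _ T1 TM] := T_system; have [_ _ piT] := pi_factor.
have [[x [y [xy pixy close]]]|noclose] := pselect (exists x y,
    [/\ x <> y, pi x = pi y & forall g, mdist (T g x) (T g y) <= eps]).
  (* This pair is close at all times, so any horoball avoiding [k] will do; the powers
     [k ^- i] of large norm with [mdist 1 (k ^- i) <= mdist k (k ^- i)] produce one. *)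
  have [i iP] := choice (fun n : nat =>
    exists_norm_nondecreasing_power d_right_invariant d_inverse n%:R k_unbounded).
  apply: (@asymptotic_pair_of_sequences _ _ _ _ T S pi eps (mdist x y) k
    (fun n => k ^- i n)%g (fun=> x) (fun=> y)) => //.
  - by rewrite mdist_gt0; exact/eqP.
  - by move=> n; have [] := iP n.
  move=> n; have [_ ] := iP n.
  rewrite /busemann /= (metric_sym _ k) (metric_sym _ 1%g).
  by rewrite -subr_ge0; apply: le_trans; rewrite oppr_le0 invr_ge0.
have step (n : nat) : exists p : G * (X * X), [/\ n%:R <= mdist 1%g p.1,
    - n.+1%:R^-1 <= busemann p.1 k, pi p.2.1 = pi p.2.2,
    eps <= mdist p.2.1 p.2.2 &
    forall h, busemann p.1 h < - n.+1%:R^-1 ->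
      mdist (T h p.2.1) (T h p.2.2) <= eps].
  have [N NP] := close_pair_among_many (n%:R + mdist 1%g k)
    d_right_invariant d_proper T_system eps_gt0.
  have [y0 /card_gt_inj[z zinj zy]] : exists y, ~ (pi @^-1` [set y] #<= `I_N)%card.
    apply: contrapT => H; apply: pi_unbounded; exists N => y.
    by apply: contrapT => Hy; apply: H; exists y.
  pose J := {p : 'I_N.+1 * 'I_N.+1 | p.1 != p.2}.
  pose A (p : J) := eps_close_times T eps (z (val p).1) (z (val p).2).
  have delta0 : 0 < n.+1%:R^-1 :> R by rewrite invr_gt0.
  have [||p [c [g [nAg ng clear gk]]]] := exists_exit_point d_right_invariant d_inverse
    (k := k) (n := n%:R) (A := A) delta0.
  - move=> m; have [i [j [ij cij]]] := NP z (k ^- m)%g.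
    by exists (exist _ (i, j) ij).
  - move=> [[i j] /= ij]; apply: contrapT => H; apply: noclose.
    exists (z i), (z j); split.
    + by move=> /zinj/eqP; exact/negP.
    + by rewrite (zy i) (zy j).
    by move=> g; apply: contrapT => Hg; apply: H; exists g.
  (* Translating by [g] moves the exit point to [1] and the centre [c] to [c * g^-1]. *)
  have dcg h : mdist (c * g^-1)%g h = mdist c (h * g)%g.
    by rewrite -(d_right_invariant g (c * g^-1)%g) mulgVK.
  have bE h : busemann (c * g^-1)%g h = mdist c (h * g)%g - mdist c g.
    by rewrite /busemann !dcg mul1g.
  exists ((c * g^-1)%g, (T g (z (val p).1), T g (z (val p).2))); split => /=.
  - by rewrite metric_sym dcg mul1g.
  - by rewrite bE lerBrDr addrC.
  - by rewrite -!piT (zy (val p).1) (zy (val p).2).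
  - by apply/ltW; rewrite ltNge; exact/negP.
  move=> h; rewrite bE !TM => hb; apply: clear.
  by rewrite ballEmdist /= -ltrBlDl.
have [p pP] := choice step.
apply: (@asymptotic_pair_of_sequences _ _ _ _ T S pi eps eps k
  (fun n => (p n).1) (fun n => (p n).2.1) (fun n => (p n).2.2)) => // n.
all: by have [] := pP n.
Qed.
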